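(* Let $G=(V,E)$ be an undirected bipartite graph, whose edges may be weighted, with fixed bipartition $V=L\cup R$, $n=|V|$ vertices and adjacency matrix $A$, and let $\lambda$ be the largest eigenvalue of $A$. For at least one of the two starting vectors $x_0=1_L$ and $x_0=1_R$ in the algorithm Density (defined in the context), there exist a time $t\le\tau$ and two indices $i$ and $j$ such that the subgraph $(X,Y)=(X^t_i,Y^t_j)$ output by the algorithm satisfies $$d(X,Y)\ \ge\ \frac{\lambda}{8+4\log n}\ \ge\ \frac{d(A)}{8+4\log n}.$$
   Context: Logarithms are base 2. $\|\cdot\|$ is the Euclidean norm, $\langle\cdot,\cdot\rangle$ the standard inner product, and vectors are row vectors indexed by $V$. If the edges are weighted, $A_{u,v}$ is the weight of the edge $\{u,v\}$. For sets of vertices $S,T$ on opposite sides of the bipartition, $(S,T)$ denotes the induced bipartite subgraph on $S\cup T$, $e(S,T)=\langle 1_SA,1_T\rangle$ is the sum of the weights of the edges between $S$ and $T$ (where $1_S$ is the indicator vector of $S$), and the density is $d(S,T)=\frac{e(S,T)}{\sqrt{|S|}\sqrt{|T|}}$. $d(A)$ is the maximum of $d(S,T)$ over all induced subgraphs $(S,T)$ with $S\subseteq L$, $T\subseteq R$. For a vector $z$, $\mathrm{round}(z)$ is obtained by rounding each nonzero entry up to the nearest power of 2, that is, replacing $z(u)$ by $2^i$ where $i$ is the smallest integer with $2^i\ge z(u)$; zero entries stay zero. For $\epsilon\ge0$, $\mathrm{prune}_\epsilon(z)$ is obtained from $z$ by setting to zero every entry with $z(u)\le\epsilon\|z\|$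 and leaving the other entries unchanged. Pruned growth process: given a starting vector $x_0$ with entries in $\{0,1\}$ and real numbers $\epsilon_t\in[0,1]$, define $x_{t+1}=\mathrm{prune}_{\epsilon_{t+1}}(\mathrm{round}(x_tA))$. Let $X^t_i$ be the set of vertices $v$ with $x_t(v)=2^i$, and $Y^t_i$ the set of vertices $v$ with $\mathrm{round}(x_tA)(v)=2^i$. Algorithm Density: run the following procedure twice, with $x_0=1_L$ and with $x_0=1_R$. Let $\tau=\lceil\log(2\sqrt n)\rceil$ and $\epsilon_t=\frac{2^t}{8\sqrt n}$. Compute the pruned growth process vectors $x_0,\dots,x_\tau$. Compute $d(X^t_i,Y^t_j)$ for each pair $i,j$ (with both sets nonempty) and each time $t<\tau$. Output the densest subgraph among the $(X^t_i,Y^t_j)$. *)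

(* Defs.v *)
From mathcomp Require Import all_boot all_order all_algebra.
From mathcomp Require Import reals exp.

Set Implicit Arguments.
Unset Strict Implicit.
Unset Printing Implicit Defensive.
Import Order.TTheory GRing.Theory Num.Theory.

Local Open Scope ring_scope.

(* Vertices are the elements of 'I_n.  The edges are the pairs of nonzero weight;
   an unweighted graph is the case of 0/1 weights. *)
Record bipartiteGraph (R : realType) (n : nat) := BipartiteGraph {
  adj : 'M[R]_n;
  lpart : {set 'I_n};
  rpart : {set 'I_n};
  adj_sym : forall u v, adj u v = adj v u;
  adj_ge0 : forall u v, 0 <= adj u v;
  part_cover : lpart :|: rpart = [set: 'I_n];
  part_disjoint : [disjoint lpart & rpart];
  adj_lpart : forall u v, u \in lpart -> v \in lpart -> adj u v = 0;
  adj_rpart : forall u v, u \in rpart -> v \in rpart -> adj u v = 0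
}.

Section Definitions.
Variables (R : realType) (n : nat).
Implicit Types (A : 'M[R]_n) (x y z : 'rV[R]_n) (S T : {set 'I_n}).
Implicit Types G : bipartiteGraph R n.

Definition largest_eigenvalue A (lam : R) : Prop :=
  eigenvalue A lam /\ forall mu : R, eigenvalue A mu -> mu <= lam.

Definition log2 (a : R) : R := ln a / ln 2.

Definition inner x y : R := \sum_(u < n) x 0 u * y 0 u.

(* The library norm on matrices is the sup norm. *)
Definition norm2 x : R := Num.sqrt (inner x x).

Definition ind S : 'rV[R]_n := \row_u (u \in S)%:R.

Definition edge_weight A S T : R := inner (ind S *m A) (ind T).

(* This is 0 as soon as S or T is empty, since a / 0 = 0. *)
Definition density A S T : R :=
  edge_weight A S T / (Num.sqrt #|S|%:R * Num.sqrt #|T|%:R).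

(* Densities are nonnegative, so the default value 0 and the pairs with an empty
   member do not affect the maximum when both sides are nonempty. *)
Definition max_density G : R :=
  \big[Num.max/0]_(S : {set 'I_n} | S \subset lpart G)
    \big[Num.max/0]_(T : {set 'I_n} | T \subset rpart G) density (adj G) S T.

(* For a > 0, see round_up_smallest below. *)
Definition round_up (a : R) : R :=
  if a == 0 then 0 else 2 ^ Num.ceil (log2 a).

Definition round z : 'rV[R]_n := map_mx round_up z.

Definition prune (eps : R) z : 'rV[R]_n :=
  \row_u (if z 0 u <= eps * norm2 z then 0 else z 0 u).

Fixpoint pruned_growth A (eps : nat -> R) x0 (t : nat) : 'rV[R]_n :=
  match t with
  | 0 => x0
  | s.+1 => prune (eps s.+1) (round (pruned_growth A eps x0 s *m A))
  end.

Definition level z (i : int) : {set 'I_n} := [set v | z 0 v == 2 ^ i].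

(* For n > 0 the ceiling is positive, so that absz is the identity here. *)
Definition tau : nat := `|Num.ceil (log2 (2 * Num.sqrt n%:R))|%N.

Definition eps_sched (t : nat) : R := 2 ^+ t / (8 * Num.sqrt n%:R).

Definition start_vector G x0 : Prop :=
  x0 = ind (lpart G) \/ x0 = ind (rpart G).

Definition density_growth G x0 t : 'rV[R]_n :=
  pruned_growth (adj G) eps_sched x0 t.

Definition Xset G x0 t (i : int) : {set 'I_n} :=
  level (density_growth G x0 t) i.

Definition Yset G x0 t (j : int) : {set 'I_n} :=
  level (round (density_growth G x0 t *m adj G)) j.

Definition density_candidate G x0 t (i j : int) : Prop :=
  [/\ start_vector G x0, (t < tau)%N,
      Xset G x0 t i != set0 & Yset G x0 t j != set0].

(* The output is a densest candidate over the two runs.  There is no candidate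
   only if the graph has no edge; in that case any pair of levels, necessarily
   with an empty member and hence of density 0, is accepted as the output. *)
Definition density_output G x0 t (i j : int) : Prop :=
  [/\ start_vector G x0, (t < tau)%N &
      forall x0' t' (i' j' : int), density_candidate G x0' t' i' j' ->
        density_candidate G x0 t i j /\
        density (adj G) (Xset G x0' t' i') (Yset G x0' t' j')
          <= density (adj G) (Xset G x0 t i) (Yset G x0 t j)].

End Definitions.

Arguments tau R n : clear implicits.

Lemma round_up_smallest (R : realType) (a : R) : 0 < a ->
  exists i : int, [/\ round_up a = 2 ^ i, a <= 2 ^ i &
    forall k : int, a <= 2 ^ k -> i <= k].
Proof.
move=> a0; exists (Num.ceil (log2 a)).
have ln2 : 0 < ln 2 :> R by rewrite ln_gt0 // ltr1n.
have E (k : int) : (a <= 2 ^ k) = (Num.ceil (log2 a) <= k).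
  rewrite ceil_le_int /log2 ler_pdivrMr // -ler_ln ?posrE ?exprz_gt0 //.
  by rewrite -powR_intmul // ln_powR.
split; first by rewrite /round_up gt_eqF.
  by rewrite E.
by move=> k; rewrite E.
Qed.

(* Main.v *)
Require Import Defs.
From mathcomp Require Import boolp classical_sets reals topology normedtype.
From mathcomp Require Import all_boot all_order all_algebra.
From mathcomp Require Import derive exp zify ring lra.

(* If w >= 0 satisfies wA >= lam w (take the absolute value of an eigenvector),
   then <xA, w> >= lam <x, w> for x >= 0.  Write m = log2 (2 sqrt n) and suppose
   that all the computed densities are below lam / (8 m).  The growth vectors
   have few dyadic levels (one at time 0, at most tau + 1 later, and tau levels of
   round (x_t A) carry 3/4 of its squared norm), so Cauchy-Schwarz over the pairs
   of levels bounds ||round (x_t A)|| by about (lam / 2)^(t + 1) sqrt n.  On the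
   other hand pruning at time t removes at most eps_t ||round (x_(t-1) A)|| from
   each entry, hence at most that much times <1_P, w> from <x_t, w>, where P is
   the current side of the bipartition.  Starting from the side with the larger
   <1_P, w>, these losses leave <x_t, w> of order lam^t <x_0, w>, and at time
   tau, where 2^tau >= 2 sqrt n, this exceeds what the norm bound allows.
   The second inequality is the Rayleigh bound on A for the vector
   1_S / sqrt |S| + 1_T / sqrt |T|. *)

Set Implicit Arguments.
Unset Strict Implicit.
Unset Printing Implicit Defensive.
Import Order.TTheory GRing.Theory Num.Theory numFieldNormedType.Exports.

Local Open Scope ring_scope.

(** * Inner products and the Rayleigh bound for symmetric matrices *)

Section Inner.
Variables (R : realType) (n : nat).
Implicit Types (A : 'M[R]_n) (x y z w : 'rV[R]_n).

Lemma innerC x y : inner x y = inner y x.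
Proof. by apply: eq_bigr => u _; rewrite mulrC. Qed.

Lemma innerDl x y z : inner (x + y) z = inner x z + inner y z.
Proof. by rewrite -big_split; apply: eq_bigr => u _; rewrite mxE mulrDl. Qed.

Lemma innerZl a x y : inner (a *: x) y = a * inner x y.
Proof. by rewrite mulr_sumr; apply: eq_bigr => u _; rewrite mxE mulrA. Qed.

Lemma innerDr x y z : inner z (x + y) = inner z x + inner z y.
Proof. by rewrite innerC innerDl !(innerC z). Qed.

Lemma innerZr a x y : inner x (a *: y) = a * inner x y.
Proof. by rewrite innerC innerZl innerC. Qed.

Lemma inner_ge0 x y : (forall u, 0 <= x 0 u) -> (forall u, 0 <= y 0 u) ->
  0 <= inner x y.
Proof. by move=> x0 y0; apply: sumr_ge0 => u _; rewrite mulr_ge0. Qed.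

Lemma ler_inner x y w : (forall u, 0 <= w 0 u) ->
  (forall u, x 0 u <= y 0 u) -> inner x w <= inner y w.
Proof. by move=> w0 xy; apply: ler_sum => u _; rewrite ler_wpM2r. Qed.

Lemma innerxx_ge0 x : 0 <= inner x x.
Proof. by apply: sumr_ge0 => u _; rewrite -expr2 sqr_ge0. Qed.

Lemma sqr_coord_le x u : x 0 u ^+ 2 <= inner x x.
Proof.
rewrite /inner (bigD1 u) //= -expr2 lerDl.
by apply: sumr_ge0 => v _; rewrite -expr2 sqr_ge0.
Qed.

Lemma innerxx_eq0 x : (inner x x == 0) = (x == 0).
Proof.
apply/eqP/eqP => [x0|->]; last by rewrite /inner big1 // => u _; rewrite mxE mul0r.
apply/rowP => u; rewrite mxE; apply/eqP; rewrite -sqrf_eq0 eq_le sqr_ge0.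
by rewrite -x0 sqr_coord_le.
Qed.

Lemma norm2_ge0 x : 0 <= norm2 x. Proof. exact: sqrtr_ge0. Qed.

Lemma sqr_norm2 x : norm2 x ^+ 2 = inner x x.
Proof. by rewrite sqr_sqrtr ?innerxx_ge0. Qed.

Lemma coord_le_norm2 x u : x 0 u <= norm2 x.
Proof.
apply: le_trans (ler_norm _) _.
by rewrite -ler_sqr ?nnegrE ?norm2_ge0 // real_normK ?num_real// sqr_norm2 sqr_coord_le.
Qed.

Lemma ler_norm2 x y : (forall u, 0 <= x 0 u <= y 0 u) -> norm2 x <= norm2 y.
Proof.
move=> xy; rewrite ler_wsqrtr //; apply: ler_sum => u _.
by have /andP[x0 le] := xy u; rewrite ler_pM.
Qed.

Lemma inner_mxE A x y :
  inner (x *m A) y = \sum_u \sum_v x 0 u * A u v * y 0 v.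
Proof.
rewrite /inner exchange_big; apply: eq_bigr => v _.
by rewrite mxE mulr_suml.
Qed.

Lemma inner_mx_sym A x y : (forall u v, A u v = A v u) ->
  inner (x *m A) y = inner (y *m A) x.
Proof.
move=> sA; rewrite !inner_mxE exchange_big; apply: eq_bigr => v _.
by apply: eq_bigr => u _; rewrite sA; ring.
Qed.

Lemma continuous_inner_mx A :
  continuous (fun x : 'rV[R]_n => inner (x *m A) x : R).
Proof.
have -> : (fun x : 'rV[R]_n => inner (x *m A) x : R) =
    (fun x => \sum_u \sum_v x 0 u * A u v * x 0 v).
  by apply/funext => x; rewrite inner_mxE.
move=> x.
have big (F : 'I_n -> 'rV[R]_n -> R) : (forall u, {for x, continuous (F u)}) ->
    {for x, continuous (fun x => \sum_u F u x)}.
  move=> Fc; apply: (@cvg_big _ _ _ _ xpredT (@add_continuous R^o) _ _ _ _ _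
    (nbhs_filter x)) => u _; exact: Fc.
apply: (big) => u; apply: (big) => v.
apply: continuousM; last exact: coord_continuous.
by apply: continuousM; [exact: coord_continuous|exact: cst_continuous].
Qed.

(** Boundedness refers to the sup norm, and each coordinate of a Euclidean unit vector is at most 1
    in absolute value. Closedness comes from continuity of the quadratic form of [1%:M]. *)
Lemma compact_sphere : compact [set x : 'rV[R]_n | inner x x = 1].
Proof.
apply: bounded_closed_compact.
  exists 1; split => // M M1 x /= x1.
  rewrite /Num.norm /= mx_normrE; apply/bigmax_leP; split=> [|[i u] _ /=]; first lra.
  rewrite (ord1 i); apply: le_trans _ (ltW M1).
  by rewrite -(@expr_le1 _ 2) // real_normK ?num_real // -x1 sqr_coord_le.
have -> : ([set x : 'rV[R]_n | inner x x = 1] =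
    (fun x => inner (x *m 1%:M) x : R) @^-1` [set a : R | a = 1])%classic.
  by apply/seteqP; split => x /=; rewrite mulmx1.
apply: preimage_closed; last exact: closed_eq.
by move=> x _; exact: continuous_inner_mx.
Qed.

(* Test positivity on x - s *: (x *m A) for a small s > 0. *)
Lemma psd_inner_eq0 A x : (forall u v, A u v = A v u) ->
  (forall y, 0 <= inner (y *m A) y) -> inner (x *m A) x = 0 -> x *m A = 0.
Proof.
move=> sA A0 xAx; apply/eqP; rewrite -innerxx_eq0; apply/eqP.
set y := x *m A; set q := inner (y *m A) y; set p := inner y y.
have q0 : 0 <= q := A0 y; have p0 : 0 <= p := innerxx_ge0 y.
have H s : 0 <= s * (s * q - 2 * p).
  have := A0 (x - s *: y).
  rewrite -scaleNr mulmxDl -scalemxAl !innerDl !innerDr !innerZl !innerZr xAx.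
  by rewrite (inner_mx_sym _ _ sA : inner (y *m A) x = p) -/q -/y -/p; lra.
have [->|pN0] := eqVneq p 0; first by [].
(* At [s = p / (q + 1)] one has [s * q = p - s < p], so [s * (s * q - 2 * p)] is negative,
   contradicting [H]. *)
have := H (p / (q + 1)); have := p0; have : 0 < p by lra.
move=> p1 _; rewrite pmulr_rge0 ?divr_gt0 //; last lra.
have -> : p / (q + 1) * q = p - p / (q+1) by field; lra.
have : 0 < p / (q + 1) by rewrite divr_gt0 //; lra.
lra.
Qed.

(** Let [c] maximize the quadratic form on the unit sphere, with value [mu]. Then [mu%:M - A] is
    positive semidefinite and its form vanishes at [c], so [c] is an eigenvector for [mu], whence
    [mu <= lam]. *)
Lemma rayleigh_le A lam : (forall u v, A u v = A v u) ->
  (forall mu, eigenvalue A mu -> mu <= lam) ->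
  forall x, inner (x *m A) x <= lam * inner x x.
Proof.
move=> sA hlam x; have [->|xN0] := eqVneq x 0.
  by rewrite mul0mx /inner !big1 ?mulr0 // => u _; rewrite mxE mul0r.
have unit z : z != 0 -> inner ((norm2 z)^-1 *: z) ((norm2 z)^-1 *: z) = 1.
  move=> z0; rewrite innerZl innerZr -sqr_norm2; field.
  by rewrite -sqrf_eq0 sqr_norm2 innerxx_eq0.
have S0 : ([set x : 'rV[R]_n | inner x x = 1] !=set0)%classic.
  by exists ((norm2 x)^-1 *: x); exact: unit.
have [c /set_mem /= c1 cmax] := EVT_max_rV S0 compact_sphere
  (continuous_subspaceT (@continuous_inner_mx A)).
set mu := inner (c *m A) c in cmax.
have Hmu z : inner (z *m A) z <= mu * inner z z.
  have [->|z0] := eqVneq z 0.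
    by rewrite mul0mx /inner !big1 ?mulr0 // => u _; rewrite mxE mul0r.
  have := cmax _ (mem_set (unit z z0)).
  have z0' : 0 < norm2 z.
    by rewrite lt_def norm2_ge0 andbT -sqrf_eq0 sqr_norm2 innerxx_eq0.
  rewrite -scalemxAl innerZl innerZr mulrA -expr2 exprVn mulrC.
  by rewrite ler_pdivrMr ?exprn_gt0 // sqr_norm2.
apply: le_trans (Hmu x) _; rewrite ler_wpM2r ?innerxx_ge0 //; apply: hlam.
apply/eigenvalueP; exists c; last first.
  by rewrite -innerxx_eq0 c1 oner_eq0.
have : c *m (mu%:M - A) = 0.
  apply: psd_inner_eq0 => [u v|y|].
  - by rewrite !mxE sA eq_sym.
  - by rewrite mulmxBr mul_mx_scalar -scaleN1r innerDl !innerZl; have := Hmu y; lra.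
  by rewrite mulmxBr mul_mx_scalar -scaleN1r innerDl !innerZl c1 -/mu; lra.
by rewrite mulmxBr mul_mx_scalar => /eqP; rewrite subr_eq0 => /eqP.
Qed.

Lemma rV_neq0_dim_gt0 (v : 'rV[R]_n) : v != 0 -> (0 < n)%N.
Proof.
rewrite lt0n; apply: contra_neq => nE; apply/rowP => u.
by have := ltn_ord u; rewrite {2}nE.
Qed.

End Inner.

(** * Rounding, pruning, and decomposition into dyadic levels *)

Section Dyadic.
Variables (R : realType) (n : nat).
Implicit Types (A : 'M[R]_n) (x y z w : 'rV[R]_n) (S T : {set 'I_n}).

Lemma exp2_gt0 (i : int) : 0 < 2 ^ i :> R.
Proof. by rewrite exprz_gt0. Qed.

Lemma exp2D (i j : int) : 2 ^ (i + j) = 2 ^ i * 2 ^ j :> R.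
Proof. by rewrite expfzDr // pnatr_eq0. Qed.

Lemma ler_exp2 (i j : int) : (2 ^ i <= 2 ^ j :> R) = (i <= j).
Proof. by rewrite ler_eXz2l // ltr1n. Qed.

Lemma exp2_le_log2 (i : int) (a : R) : 0 < a -> (2 ^ i <= a) = (i%:~R <= log2 a).
Proof.
move=> a0; rewrite /log2 ler_pdivlMr ?ln_gt0 ?ltr1n // -ler_ln ?posrE ?exp2_gt0 //.
by rewrite -powR_intmul // ln_powR.
Qed.

Lemma round_up_bounds (a : R) : 0 <= a -> a <= round_up a <= 2 * a.
Proof.
rewrite le_eqVlt => /predU1P[<-|a0]; first by rewrite /round_up eqxx mulr0 lexx.
have [i [-> -> min_i]] := round_up_smallest a0.
have : ~~ (a <= 2 ^ (i - 1)).
  by apply/negP => /min_i; rewrite lerBrDr -subr_ge0 opprD addNKr.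
by rewrite -ltNge exp2D exprN1; lra.
Qed.

Lemma round_up_dyadic (a : R) : 0 <= a ->
  round_up a = 0 \/ exists i : int, round_up a = 2 ^ i.
Proof.
rewrite le_eqVlt => /predU1P[<-|a0]; first by left; rewrite /round_up eqxx.
by right; have [i [-> _ _]] := round_up_smallest a0; exists i.
Qed.

Lemma le_prune eps z u : (forall u, 0 <= z 0 u) -> 0 <= prune eps z 0 u <= z 0 u.
Proof. by move=> z0; rewrite mxE; case: ifP; rewrite z0 lexx. Qed.

(** Each of the at most [n] pruned entries costs at most [(eps * norm2 z) ^+ 2]. *)
Lemma sqr_norm2_prune_ge eps z : 0 <= eps -> (forall u, 0 <= z 0 u) ->
  (1 - n%:R * eps ^+ 2) * norm2 z ^+ 2 <= norm2 (prune eps z) ^+ 2.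
Proof.
move=> e0 z0; rewrite mulrBl mul1r lerBlDr !sqr_norm2.
have -> : n%:R * eps ^+ 2 * inner z z = \sum_(u < n) (eps * norm2 z) ^+ 2.
  rewrite sumr_const card_ord exprMn sqr_norm2 -[RHS]mulr_natl; ring.
rewrite -big_split; apply: ler_sum => u _ /=; rewrite mxE -!expr2.
have := z0 u; case: ifP => [zle z0u|_ _]; last by rewrite lerDl sqr_ge0.
by rewrite expr0n add0r ler_pXn2r ?nnegrE // (le_trans z0u).
Qed.

(** The top exponent [b] is existential because only the number [K] of possible levels enters the
    Cauchy-Schwarz bounds. *)
Definition dyadic K x := exists b : int, forall u,
  x 0 u = 0 \/ exists2 k, (k < K)%N & x 0 u = 2 ^ (b - k%:Z).

(** Surviving entries exceed [2 ^- K * norm2 z] and are at most [norm2 z]; this window contains at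
    most [K] powers of 2, the largest being the floor power of the norm. *)
Lemma dyadic_prune K eps z :
  (forall u, z 0 u = 0 \/ exists i : int, z 0 u = 2 ^ i) ->
  2 ^- K <= eps -> dyadic K (prune eps z).
Proof.
move=> zd Keps; have e0 : 0 <= eps by apply: le_trans Keps; rewrite invr_ge0 exprn_ge0.
have [N0|N0] := eqVneq (norm2 z) 0.
  exists 0 => u; left; rewrite mxE N0 mulr0.
  by case: ifPn => //; rewrite -ltNge -N0 ltNge coord_le_norm2.
have {}N0 : 0 < norm2 z by rewrite lt_def N0 norm2_ge0.
exists (Num.floor (log2 (norm2 z))) => u; set b := Num.floor _.
have bN : 2 ^ b <= norm2 z by rewrite exp2_le_log2 // floor_le.
rewrite mxE; case: ifPn => [|]; first by left.
rewrite -ltNge => zu; have [->|[i zi]] := zd u; first by left.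
have ib : i <= b by rewrite /b floor_ge_int -exp2_le_log2 // -zi coord_le_norm2.
right; exists `|b - i|%N; last by rewrite zi; congr (_ ^ _); lia.
have : 2 ^ (b - K%:Z) < 2 ^ i :> R.
  rewrite -zi; apply: le_lt_trans zu; rewrite exp2D mulrC -exprnN.
  by apply: ler_pM => //; rewrite ?invr_ge0 ?exprn_ge0 // ltW // exp2_gt0.
by rewrite ltNge ler_exp2 -ltNge; lia.
Qed.

Lemma dyadic_ind S : dyadic 1 (ind R S).
Proof.
exists 0 => u; rewrite mxE; case: (u \in S); last by left.
by right; exists 0%N.
Qed.

(** Used with [f] the identity to split a vector into level indicators, and with [f] the square to
    split its squared norm. *)
Lemma dyadic_sum_levels K b x (f : R -> R) u : f 0 = 0 ->
  (forall u, x 0 u = 0 \/ exists2 k, (k < K)%N & x 0 u = 2 ^ (b - k%:Z)) ->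
  f (x 0 u) = \sum_(k < K) f (2 ^ (b - k%:Z)) * (u \in level x (b - k%:Z))%:R.
Proof.
move=> f0 /(_ u)[xu|[k kK xu]].
  rewrite xu f0 big1 // => k _.
  by rewrite inE xu lt_eqF ?exp2_gt0 // mulr0.
rewrite (bigD1 (Ordinal kK)) //= big1 ?addr0 => [|l /eqP lk].
  by rewrite inE xu eqxx mulr1.
rewrite inE xu (inj_eq (@ieexprIz R 2 _ _)) //; last by rewrite pnatr_eq1.
case: eqP => [E|_]; last by rewrite mulr0.
by case: lk; apply/val_inj => /=; lia.
Qed.

(** Cauchy-Schwarz against the constant vector, from the nonnegativity of the rescaled sum of
    squared deviations from the mean. *)
Lemma sqr_sum_le K (b : 'I_K -> R) : (\sum_k b k) ^+ 2 <= K%:R * \sum_k b k ^+ 2.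
Proof.
case: K b => [|K] b; first by rewrite !big_ord0 expr0n mulr0.
set s := \sum_k b k; set q := \sum_k b k ^+ 2.
have : 0 <= \sum_k (K.+1%:R * b k - s) ^+ 2 by apply: sumr_ge0 => k _; rewrite sqr_ge0.
have -> : \sum_k (K.+1%:R * b k - s) ^+ 2 = K.+1%:R * (K.+1%:R * q - s ^+ 2).
  transitivity (\sum_k (K.+1%:R ^+ 2 * b k ^+ 2 + - (2 * K.+1%:R * s) * b k + s ^+ 2)).
    by apply: eq_bigr => k _; ring.
  rewrite !big_split /= -!mulr_sumr -/q -/s sumr_const card_ord -mulr_natl; ring.
by rewrite pmulr_rge0 ?ltr0Sn // subr_ge0.
Qed.

(** For an empty set the division by 0 makes the density 0, but the edge weight vanishes too, so
    clearing the denominator remains valid. *)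
Lemma edge_weight_le_density A S T d : density A S T <= d ->
  edge_weight A S T <= d * (Num.sqrt #|S|%:R * Num.sqrt #|T|%:R).
Proof.
rewrite /density; set s := Num.sqrt _; set t := Num.sqrt _.
have ind0 (U : {set 'I_n}) : Num.sqrt #|U|%:R = 0 :> R -> ind R U = 0.
  move/eqP; rewrite sqrtr_eq0 lern0 cards_eq0 => /eqP ->.
  by apply/rowP => u; rewrite !mxE inE.
have [s0 _|s0] := eqVneq s 0.
  rewrite /edge_weight ind0 // mul0mx s0 mul0r mulr0 /inner big1 // => u _.
  by rewrite mxE mul0r.
have [t0 _|t0] := eqVneq t 0.
  rewrite /edge_weight (ind0 T) // t0 !mulr0 /inner big1 // => u _.
  by rewrite [X in _ * X]mxE mulr0.
by rewrite ler_pdivrMr // mulr_gt0 // lt_def sqrtr_ge0 andbT.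
Qed.

Lemma sum_levels_le K b x :
  (forall u, x 0 u = 0 \/ exists2 k, (k < K)%N & x 0 u = 2 ^ (b - k%:Z)) ->
  \sum_(k < K) 2 ^ (b - k%:Z) * Num.sqrt #|level x (b - k%:Z)|%:R
    <= Num.sqrt K%:R * norm2 x.
Proof.
move=> xd; apply: le_trans (ler_norm _) _.
rewrite -sqrtr_sqr -sqrtrM // ler_wsqrtr //.
apply: le_trans (sqr_sum_le _) _; rewrite ler_wpM2l // le_eqVlt; apply/orP; left.
apply/eqP; transitivity (\sum_u \sum_(k < K)
    (2 ^ (b - k%:Z)) ^+ 2 * (u \in level x (b - k%:Z))%:R : R); last first.
  apply: eq_bigr => u _; rewrite -expr2.
  by rewrite -(dyadic_sum_levels (f := fun a => a ^+ 2)) // expr0n.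
rewrite exchange_big; apply: eq_bigr => k _ /=.
rewrite exprMn sqr_sqrtr // -mulr_sumr -natr_sum -sum1_card big_mkcond.
by congr (_ * _%:R); apply: eq_bigr => u _; case: (u \in _).
Qed.

(** A pair of levels with values [2 ^ i], [2 ^ j] and sets X, Y contributes at most [d] times
    [2 ^ i * sqrt #|X|] times [2 ^ j * sqrt #|Y|]. The double sum of these factors into two sums,
    each bounded by [sum_levels_le]. *)
Lemma inner_le_density A x y K L d : 0 <= d -> dyadic K x -> dyadic L y ->
  (forall i j, density A (level x i) (level y j) <= d) ->
  inner (x *m A) y <= d * (Num.sqrt K%:R * norm2 x) * (Num.sqrt L%:R * norm2 y).
Proof.
move=> d0 [b xd] [c yd] hd.
pose X (k : 'I_K) := level x (b - k%:Z); pose Y (l : 'I_L) := level y (c - l%:Z).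
have ->: inner (x *m A) y = \sum_(k < K) \sum_(l < L)
    2 ^ (b - k%:Z) * 2 ^ (c - l%:Z) * edge_weight A (X k) (Y l).
  have E K' a z : (forall u, z 0 u = 0 \/ exists2 k, (k < K')%N & z 0 u = 2 ^ (a - k%:Z)) ->
      z = \sum_(k < K') 2 ^ (a - k%:Z) *: ind R (level z (a - k%:Z)).
    move=> zd; apply/rowP => u; rewrite summxE (dyadic_sum_levels (f := id) _ _ zd) //.
    by apply: eq_bigr => k _; rewrite !mxE.
  rewrite {1}(E _ _ _ xd) {1}(E _ _ _ yd) mulmx_suml.
  rewrite (big_morph (fun z => inner z _) (fun a b => innerDl a b _) (_ : _ = 0)); last first.
    by rewrite /inner big1 // => u _; rewrite mxE mul0r.
  apply: eq_bigr => k _; rewrite -scalemxAl innerZl.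
  rewrite (big_morph (inner _) (fun a b => innerDr a b _) (_ : _ = 0)); last first.
    by rewrite /inner big1 // => u _; rewrite [X in _ * X]mxE mulr0.
  by rewrite mulr_sumr; apply: eq_bigr => l _; rewrite innerZr mulrA.
have le_xy := ler_pM _ _ (sum_levels_le xd) (sum_levels_le yd).
rewrite -mulrA; apply: le_trans (ler_wpM2l d0 (le_xy _ _)).
- rewrite mulr_suml mulr_sumr; apply: ler_sum => k _.
  rewrite !mulr_sumr; apply: ler_sum => l _.
  apply: le_trans (ler_wpM2l _ (edge_weight_le_density (hd _ _))) _.
    by rewrite ltW // mulr_gt0 // exp2_gt0.
  by rewrite le_eqVlt; apply/orP; left; apply/eqP; rewrite /X /Y; ring.
- by apply: sumr_ge0 => k _; rewrite mulr_ge0 ?sqrtr_ge0 // ltW // exp2_gt0.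
- by apply: sumr_ge0 => k _; rewrite mulr_ge0 ?sqrtr_ge0 // ltW // exp2_gt0.
Qed.

End Dyadic.

(** * Norm growth in one step, and the numerical rates *)

Section Growth.
Variables (R : realType) (n : nat).
Implicit Types (A : 'M[R]_n) (x z : 'rV[R]_n) (S T : {set 'I_n}).

Lemma density_ge0 A S T : (forall u v, 0 <= A u v) -> 0 <= density A S T.
Proof.
move=> A0; rewrite divr_ge0 ?mulr_ge0 ?sqrtr_ge0 // /edge_weight inner_mxE.
by do 2![apply: sumr_ge0 => ? _]; rewrite !mulr_ge0 // mxE ler0n.
Qed.

Lemma density_set0 A S T : S = set0 \/ T = set0 -> density A S T = 0.
Proof.
by rewrite /density => -[] ->; rewrite cards0 sqrtr0 ?mulr0 ?mul0r invr0 mulr0.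
Qed.

(** Pruning compares values with one threshold, so a level survives whole or disappears; density
    bounds thus pass to pruned vectors. *)
Lemma level_prune eps z j : level (prune eps z) j = set0 \/
  level (prune eps z) j = level z j.
Proof.
have [->|[v]] := set_0Vmem (level (prune eps z) j).
  by left.
move=> vj; right; move: vj; rewrite inE mxE; case: ifPn => [_|zv /eqP vj].
  by rewrite lt_eqF ?exp2_gt0.
apply/setP => u; rewrite !inE mxE; case: ifPn => // zu.
rewrite lt_eqF ?exp2_gt0 //; apply/esym/negbTE/eqP => uj.
by move: zv; rewrite vj -uj zu.
Qed.

Lemma mulmx_ge0 A x : (forall u v, 0 <= A u v) -> (forall u, 0 <= x 0 u) ->
  forall u, 0 <= (x *m A) 0 u.
Proof. by move=> A0 x0 u; rewrite mxE sumr_ge0 // => v _; rewrite mulr_ge0. Qed.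

(** An auxiliary pruning of [y] at [1 / (2 * sqrt n)], distinct from that of the algorithm, gives
    [y'] with at most [L] levels and at least 3/4 of the squared norm of [y]. Rounding at most
    doubles, so the squared norm of [y'] is at most [2 * inner (x *m A) y']; [inner_le_density]
    bounds this, and one factor [norm2 y'] cancels. *)
Lemma norm2_round_le A x K L d : (forall u v, 0 <= A u v) -> (forall u, 0 <= x 0 u) ->
  (0 < n)%N -> 0 <= d -> dyadic K x -> 2 ^- L <= (2 * Num.sqrt n%:R)^-1 :> R ->
  (forall i j, density A (level x i) (level (round (x *m A)) j) <= d) ->
  3 * norm2 (round (x *m A)) ^+ 2 <= 16 * d ^+ 2 * (K * L)%:R * norm2 x ^+ 2.
Proof.
move=> A0 x0 n0 d0 xd nL hd; set y := round _.
have y_bounds u : (x *m A) 0 u <= y 0 u <= 2 * (x *m A) 0 u.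
  by rewrite [y 0 u]mxE round_up_bounds // mulmx_ge0.
have y0 u : 0 <= y 0 u by have /andP[+ _] := y_bounds u; apply/le_trans/mulmx_ge0.
set e := (2 * _)^-1 in nL; set y' := prune e y.
have e0 : 0 <= e by rewrite invr_ge0 mulr_ge0 // sqrtr_ge0.
have y'0 u : 0 <= y' 0 u by have /andP[] := le_prune e u y0.
have y'd : dyadic L y'.
  by apply: dyadic_prune nL => u; rewrite mxE; apply/round_up_dyadic/mulmx_ge0.
have dens i j : density A (level x i) (level y' j) <= d.
  by have [E|->] := level_prune e y j; rewrite ?hd // density_set0 //; right.
have := sqr_norm2_prune_ge e0 y0; rewrite -/y'.
have -> : n%:R * e ^+ 2 = 1 / 4.
  rewrite exprVn exprMn sqr_sqrtr // /e; field.
  by rewrite pnatr_eq0 -lt0n.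
move=> big.
have : norm2 y' ^+ 2 <= 2 * inner (x *m A) y'.
  rewrite sqr_norm2 -innerZl; apply: ler_inner => // u.
  have /andP[_ le] := le_prune e u y0; apply: le_trans le _.
  by have /andP[_ le] := y_bounds u; rewrite [leRHS]mxE.
have := inner_le_density d0 xd y'd dens.
set p := norm2 x; set q := norm2 y' => le1 le2; rewrite -/q in big.
set k := Num.sqrt K%:R in le1; set l := Num.sqrt L%:R in le1.
have k2 : k ^+ 2 = K%:R by rewrite sqr_sqrtr.
have l2 : l ^+ 2 = L%:R by rewrite sqr_sqrtr.
have q0 : 0 <= q := norm2_ge0 _; have p0 : 0 <= p := norm2_ge0 _.
have k0 : 0 <= k := sqrtr_ge0 _; have l0 : 0 <= l := sqrtr_ge0 _.
have qle : q <= 2 * d * k * l * p.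
  have [->|qN0] := eqVneq q 0; first by rewrite !mulr_ge0.
  have qp : 0 < q by rewrite lt_def qN0.
  rewrite -(ler_pM2r qp) -expr2; apply: le_trans le2 _.
  apply: le_trans (ler_wpM2l (ler0n R 2) le1) _.
  by rewrite le_eqVlt; apply/orP; left; apply/eqP; ring.
have : q ^+ 2 <= (2 * d * k * l * p) ^+ 2 by rewrite ler_pXn2r ?nnegrE ?mulr_ge0.
move=> q2; apply: le_trans (_ : 4 * q ^+ 2 <= _); first lra.
apply: le_trans (ler_wpM2l (ler0n R 4) q2) _.
by rewrite !exprMn natrM k2 l2 le_eqVlt; apply/orP; left; apply/eqP; ring.
Qed.

(** With [k] the number of pairs of levels and [d = lam / (8 * m)], the condition on [k] makes
    [16 * d ^+ 2 * k] at most [3 * (lam / 2 * c) ^+ 2]. *)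
Lemma le_of_sqr_density_bound (lam m c k p q : R) : 0 <= lam -> 0 < m -> 0 <= c ->
  0 <= p -> 0 <= q -> k <= 3 * m ^+ 2 * c ^+ 2 ->
  3 * q ^+ 2 <= 16 * (lam / (8 * m)) ^+ 2 * k * p ^+ 2 -> q <= lam / 2 * c * p.
Proof.
move=> lam0 m0 c0 p0 q0 kc le.
rewrite -ler_sqr ?nnegrE ?mulr_ge0 ?invr_ge0 //.
rewrite -(ler_pM2l (ltr0n R 3)); apply: le_trans le _.
have -> : 3 * (lam / 2 * c * p) ^+ 2 =
    16 * (lam / (8 * m)) ^+ 2 * (3 * m ^+ 2 * c ^+ 2) * p ^+ 2.
  by field; rewrite gt_eqF.
by rewrite ler_wpM2r ?sqr_ge0 // ler_wpM2l // mulr_ge0 ?sqr_ge0.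
Qed.

(* c0 and c bound twice the relative growth of the norm at time 0 and at later
   times; the last clause bounds the pruning losses plus the final norm. The case
   T >= 3 sums a geometric series; for smaller T the rate c may exceed 1. *)
Lemma decay_rates (T : nat) (m : R) : 1 <= m -> T%:R <= m ->
  exists c0 c : R, [/\ 0 <= c0, 0 <= c, T.+1%:R <= 3 * m ^+ 2 * c0 ^+ 2,
    (T.+2 * T.+1)%:R <= 3 * m ^+ 2 * c ^+ 2 &
    \sum_(s < T) c0 * c ^+ s / 8 + c0 * c ^+ T / 2 < 1].
Proof.
move=> m1 Tm; have m2 : 1 <= m ^+ 2 by rewrite exprn_ege1.
have Tm2 : T%:R ^+ 2 <= m ^+ 2 by rewrite ler_pXn2r ?nnegrE //; lra.
case: T Tm Tm2 => [|[|[|T]]] Tm Tm2.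
- exists (3 / 5), 2; split; rewrite ?big_ord0 ?expr0; lra.
- exists (9 / 10), (3 / 2); split; rewrite ?big_ord1 /= ?expr0 ?expr1; lra.
- exists (3 / 5), 1; split; rewrite ?big_ord_recl ?big_ord0 /= ?expr1n; lra.
have T3 : T.+3%:R = T%:R + 3 :> R by rewrite -addn3 natrD.
have T4 : T.+4%:R = T%:R + 4 :> R by rewrite -addn4 natrD.
have T5 : T.+4.+1%:R = T%:R + 5 :> R by rewrite -addn1 natrD T4; lra.
(* The factors 3/4 and 147/64 below are [3 * c0 ^+ 2] and [3 * c ^+ 2]. The second bound is nearly
   tight at the smallest case, where 20 is compared with 147 * 9 / 64. *)
exists (1 / 2), (7 / 8); split; try lra.
- apply: le_trans (_ : 3 / 4 * T.+3%:R ^+ 2 <= _); last lra.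
  rewrite T3 T4; have := ler0n R T.
  by have := sqr_ge0 (T%:R : R); nra.
- apply: le_trans (_ : 147 / 64 * T.+3%:R ^+ 2 <= _); last lra.
  rewrite natrM T3 T4 T5; have := ler0n R T.
  by have := ler0n R T; have := sqr_ge0 (T%:R : R); nra.
have c0 : 0 <= (7 / 8) ^+ T.+3 :> R by rewrite exprn_ge0 //; lra.
have -> : \sum_(s < T.+3) (1 / 2) * (7 / 8) ^+ s / 8 = (1 - (7 / 8) ^+ T.+3) / 2 :> R.
  elim: T.+3 => [|k IH]; first by rewrite big_ord0 expr0; lra.
  by rewrite big_ord_recr /= IH exprS; lra.
lra.
Qed.

End Growth.

(** * Bounds on the number of steps *)

Section Tau.
Variables (R : realType) (n : nat).
Hypothesis n_gt0 : (0 < n)%N.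

Let sqrt_gt0 : 0 < Num.sqrt n%:R :> R.
Proof. by rewrite sqrtr_gt0 ltr0n. Qed.

Lemma log2_ge0 : 0 <= log2 n%:R :> R.
Proof. by rewrite divr_ge0 ?ln_ge0 ?ler1n. Qed.

(** This value [m] satisfies [8 * m = 8 + 4 * log2 n], the denominator in the theorem. *)
Lemma log2_2sqrt : log2 (2 * Num.sqrt n%:R) = 1 + log2 n%:R / 2 :> R.
Proof.
have [l [l0 ln2 log2E]] : exists l : R, [/\ l != 0, ln 2 = l & forall a, log2 a = ln a / l].
  by exists (ln 2); split=> //; rewrite gt_eqF // ln_gt0 // ltr1n.
rewrite !log2E lnM ?posrE // ln2 -{2}[n%:R](@sqr_sqrtr R) // lnXn // -mulr_natl.
by field.
Qed.

Lemma tau_gt0 : (0 < tau R n)%N.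
Proof.
rewrite absz_gt0 gt_eqF // ceil_gt0 log2_2sqrt.
by have := log2_ge0; lra.
Qed.

Lemma tauE : (tau R n)%:R = (Num.ceil (1 + log2 n%:R / 2 : R))%:~R :> R.
Proof.
rewrite -log2_2sqrt natr_absz ger0_norm // ltW // ceil_gt0 log2_2sqrt.
by have := log2_ge0; lra.
Qed.

(** The lower bound yields [2 ^+ tau >= 2 * sqrt n]; the upper one yields [tau - 1 <= m], as
    [decay_rates] requires. *)
Lemma tau_bounds :
  1 + (log2 n%:R : R) / 2 <= ((tau R n)%:R : R) < 2 + (log2 n%:R : R) / 2.
Proof.
rewrite tauE; have /andP[] := ceil_itv (1 + log2 n%:R / 2 : R).
by rewrite intrD; lra.
Qed.

Lemma two_sqrt_le_exp_tau : 2 * Num.sqrt n%:R <= 2 ^+ tau R n :> R.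
Proof.
rewrite -ler_ln ?posrE ?mulr_gt0 ?exprn_gt0 // lnXn // -[leRHS]mulr_natl.
have ln2 : 0 < ln 2 :> R by rewrite ln_gt0 // ltr1n.
rewrite -ler_pdivrMr // -/(log2 _) log2_2sqrt.
by have /andP[] := tau_bounds.
Qed.

End Tau.

(** * Spectral facts for bipartite graphs, and vectors supported on one side *)

Section Density.
Variables (R : realType) (n : nat) (G : bipartiteGraph R n).
Implicit Types (x z w : 'rV[R]_n) (S T : {set 'I_n}).
Local Notation A := (adj G).
Local Notation L := (lpart G).
Local Notation Rt := (rpart G).

Let A0 := adj_ge0 G.
Let sA := adj_sym G.

Lemma lpartN u : (u \notin L) = (u \in Rt).
Proof.
have := in_setT u; rewrite -(part_cover G) inE.
by have := disjointFr (part_disjoint G) (x := u); case: (u \in L) => //= ->.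
Qed.

Lemma rpartN u : (u \notin Rt) = (u \in L).
Proof. by rewrite -lpartN negbK. Qed.

Lemma eigenvalue_ge0 lam : largest_eigenvalue A lam -> 0 <= lam.
Proof.
move=> [/eigenvalueP[v vA v0] hmax].
(* Changing the sign on one side of the bipartition negates eigenvalues. *)
suff : - lam <= lam by lra.
apply: hmax; apply/eigenvalueP.
pose s u : R := if u \in L then 1 else -1.
have ss u : s u * s u = 1 by rewrite /s; case: ifP => _; lra.
exists (\row_u (s u * v 0 u)); last first.
  apply: contra_neq v0 => sv0; apply/rowP => u.
  have /rowP/(_ u) := sv0; rewrite !mxE => su.
  by rewrite -[v 0 u]mul1r -(ss u) -mulrA su mulr0.
apply/rowP => u; rewrite !mxE.
transitivity (- s u * \sum_k v 0 k * A k u).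
  rewrite mulr_sumr; apply: eq_bigr => k _; rewrite mxE /s.
  case: ifPn => kL; case: ifPn => uL; try ring.
    by rewrite (adj_lpart kL uL); ring.
  by rewrite !lpartN in kL uL; rewrite (adj_rpart kL uL); ring.
have := congr1 (fun y : 'rV[R]_n => y 0 u) vA; rewrite !mxE => ->; ring.
Qed.

(** The normalized indicators of [S] and [T] are orthonormal, so their sum has squared norm 2. No
    edge lies within a side, so the quadratic form at this sum is twice the density. *)
Lemma density_le lam S T : largest_eigenvalue A lam ->
  S \subset L -> T \subset Rt -> density A S T <= lam.
Proof.
move=> hlam SL TR; have lam0 := eigenvalue_ge0 hlam.
have [S0|S0] := eqVneq S set0; first by rewrite density_set0 //; left.
have [T0|T0] := eqVneq T set0; first by rewrite density_set0 //; right.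
set s := Num.sqrt (#|S|%:R : R); set t := Num.sqrt (#|T|%:R : R).
have s0 : 0 < s by rewrite sqrtr_gt0 ltr0n card_gt0.
have t0 : 0 < t by rewrite sqrtr_gt0 ltr0n card_gt0.
have inner_ind (U U' : {set 'I_n}) : inner (ind R U) (ind R U') = #|U :&: U'|%:R :> R.
  rewrite /inner -sum1_card natr_sum [RHS]big_mkcond; apply: eq_bigr => u _.
  by rewrite !mxE inE -natrM mulnb; case: ifP.
have TS : T :&: S = set0.
  apply/setP => u; rewrite !inE; apply/negbTE/negP => /andP[uT uS].
  by have := subsetP SL _ uS; rewrite -rpartN (subsetP TR _ uT).
have edge0 (U P : {set 'I_n}) : U \subset P ->
    (forall u v, u \in P -> v \in P -> A u v = 0) -> edge_weight A U U = 0.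
  move=> UP P0; rewrite /edge_weight inner_mxE big1 // => u _; rewrite big1 // => v _.
  rewrite !mxE; case: (boolP (u \in U)) => uU; last by rewrite !mul0r.
  case: (boolP (v \in U)) => vU; last by rewrite mulr0.
  by rewrite P0 ?mulr0 ?mul0r // (subsetP UP).
have := rayleigh_le sA hlam.2 (s^-1 *: ind R S + t^-1 *: ind R T).
rewrite mulmxDl -!scalemxAl !innerDl !innerDr !innerZl !innerZr -!/(edge_weight _ _ _).
rewrite (edge0 S L) ?(edge0 T Rt) //; try exact: adj_lpart; try exact: adj_rpart.
have -> : edge_weight A T S = edge_weight A S T by exact: inner_mx_sym.
rewrite !inner_ind [S :&: T]setIC TS cards0 !setIid.
have -> : #|S|%:R = s ^+ 2 :> R by rewrite sqr_sqrtr.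
have -> : #|T|%:R = t ^+ 2 :> R by rewrite sqr_sqrtr.
have -> : density A S T = s^-1 * (t^-1 * edge_weight A S T).
  by rewrite /density -/s -/t invfM; ring.
have -> : s^-1 * (s^-1 * s ^+ 2) = 1 by field; rewrite gt_eqF.
have -> : t^-1 * (t^-1 * t ^+ 2) = 1 by field; rewrite gt_eqF.
by rewrite [t^-1 * (s^-1 * _)]mulrCA; lra.
Qed.

Lemma max_density_le lam : largest_eigenvalue A lam -> max_density G <= lam.
Proof.
move=> hlam; have lam0 := eigenvalue_ge0 hlam.
apply/bigmax_leP; split=> // S SL; apply/bigmax_leP; split=> // T TR.
exact: density_le.
Qed.

(** Triangle inequality in each coordinate of [v *m A], the entries of [A] being nonnegative. *)
Lemma subeigenvector lam : eigenvalue A lam -> 0 <= lam ->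
  exists2 w : 'rV[R]_n, (forall u, 0 <= w 0 u) /\ w != 0 &
    forall u, lam * w 0 u <= (w *m A) 0 u.
Proof.
move=> /eigenvalueP[v vA v0] lam0; exists (\row_u `|v 0 u|).
  split=> [u|]; first by rewrite mxE.
  apply: contra_neq v0 => /rowP w0; apply/rowP => u.
  by have /eqP := w0 u; rewrite !mxE normr_eq0 => /eqP.
move=> u; have := congr1 (fun y : 'rV[R]_n => y 0 u) vA; rewrite !mxE => E.
rewrite -{1}(ger0_norm lam0) -normrM -E; apply: le_trans (ler_norm_sum _ _ _) _.
by apply: ler_sum => k _; rewrite mxE normrM (ger0_norm (A0 _ _)).
Qed.

(** The growth vectors alternate between the sides. The disjunction avoids tracking the parity of
    the time, since the start will be chosen so that its weight dominates both sides. *)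
Definition one_sided z :=
  (forall u, u \notin L -> z 0 u = 0) \/ (forall u, u \notin Rt -> z 0 u = 0).

Lemma one_sided_mulmx z : one_sided z -> one_sided (z *m A).
Proof.
case=> z0; [right=> u|left=> u]; rewrite ?lpartN ?rpartN => uP;
  rewrite mxE big1 // => v _.
- have [vL|vL] := boolP (v \in L); first by rewrite (adj_lpart vL uP) mulr0.
  by rewrite z0 ?mul0r.
- have [vR|vR] := boolP (v \in Rt); first by rewrite (adj_rpart vR uP) mulr0.
  by rewrite z0 ?mul0r.
Qed.

Lemma one_sided_inner_le z w b a : (forall u, 0 <= w 0 u) -> one_sided z ->
  (forall u, z 0 u <= b) -> 0 <= b ->
  inner (ind R L) w <= a -> inner (ind R Rt) w <= a -> inner z w <= b * a.
Proof.
move=> w0 zside zb b0 La Ra.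
suff [P Pa Pz] : exists2 P, inner (ind R P) w <= a & forall u, u \notin P -> z 0 u = 0.
  apply: le_trans (ler_wpM2l b0 Pa); rewrite -innerZl; apply: ler_inner => // u.
  rewrite !mxE; have [_|uP] := boolP (u \in P); first by rewrite mulr1.
  by rewrite Pz // mulr0.
by case: zside; [exists L|exists Rt].
Qed.

(** * One run of the algorithm *)

Section Run.
Variable x0 : 'rV[R]_n.
Hypothesis start : start_vector G x0.
Hypothesis n_gt0 : (0 < n)%N.
Local Notation xs := (density_growth G x0).
Local Notation ys t := (round (density_growth G x0 t *m A)).

Lemma growth_ge0 t u : 0 <= xs t 0 u.
Proof.
elim: t u => [|t IH] u.
  by case: start => ->; rewrite mxE ler0n.
have y0 v : 0 <= ys t 0 v.
  rewrite mxE; have z0 : 0 <= (xs t *m A) 0 v by exact: mulmx_ge0.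
  by have /andP[+ _] := round_up_bounds z0; apply: le_trans.
by have /andP[] := le_prune (eps_sched R n t.+1) u y0.
Qed.

Lemma round_growth_bounds t u :
  (xs t *m A) 0 u <= ys t 0 u <= 2 * (xs t *m A) 0 u.
Proof.
by rewrite [ys t 0 u]mxE round_up_bounds // mulmx_ge0 //; exact: growth_ge0.
Qed.

Lemma round_growth_ge0 t u : 0 <= ys t 0 u.
Proof.
have /andP[+ _] := round_growth_bounds t u; apply: le_trans.
by apply: mulmx_ge0 => //; exact: growth_ge0.
Qed.

Lemma round_growth_one_sided t : one_sided (xs t) -> one_sided (ys t).
Proof.
by move/one_sided_mulmx=> [] h; [left|right] => u /h E; rewrite mxE E /round_up eqxx.
Qed.

Lemma growth_one_sided t : one_sided (xs t).
Proof.
elim: t => [|t /round_growth_one_sided IH].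
  by case: start => ->; [left|right] => u /negbTE uP; rewrite mxE uP.
case: IH => h; [left|right] => u /h; rewrite [xs t.+1 0 u]mxE => ->;
  by case: ifP.
Qed.

Lemma eps_sched_ge0 t : 0 <= eps_sched R n t.
Proof. by rewrite divr_ge0 ?exprn_ge0 ?mulr_ge0 ?sqrtr_ge0. Qed.

Lemma sqrt_n_gt0 : 0 < Num.sqrt n%:R :> R.
Proof. by rewrite sqrtr_gt0 ltr0n. Qed.

(** For [t > 0] the threshold is at least its value [1 / (4 * sqrt n)] at time 1, which is at least
    [2 ^- (tau + 1)]. *)
Lemma growth_dyadic t : dyadic (if t is 0 then 1 else (tau R n).+1) (xs t).
Proof.
case: t => [|t]; first by case: start => ->; exact: dyadic_ind.
apply: dyadic_prune => [u|].
  by rewrite mxE; apply/round_up_dyadic/mulmx_ge0 => // v; exact: growth_ge0.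
have le := two_sqrt_le_exp_tau R n_gt0; have s0 := sqrt_n_gt0.
rewrite /eps_sched ler_pdivlMr ?mulr_gt0 // mulrC ler_pdivrMr ?exprn_gt0 //.
have p1 : 1 <= 2 ^+ t :> R by rewrite exprn_ege1 // ler1n.
have p2 : 2 ^+ tau R n <= 2 ^+ t * 2 ^+ tau R n :> R by rewrite ler_peMl // exprn_ge0.
rewrite [2 ^+ (tau R n).+1]exprS [2 ^+ t.+1]exprS.
move: (2 ^+ tau R n) (2 ^+ t) le p1 p2 => X Y le p1 p2; lra.
Qed.

Lemma norm2_growth0 : norm2 (xs 0) <= Num.sqrt n%:R.
Proof.
rewrite /norm2 ler_wsqrtr //.
rewrite -[n in n%:R]card_ord -sum1_card natr_sum; apply: ler_sum => u _.
by case: start => ->; rewrite mxE -natrM ler_nat mulnb leq_b1.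
Qed.

Lemma norm2_growthS t : norm2 (xs t.+1) <= norm2 (ys t).
Proof. by apply: ler_norm2 => u; apply/le_prune/round_growth_ge0. Qed.

(** * Norm growth when all computed densities are at most [lam / (8 * m)] *)

Variables (lam : R).
Local Notation m := (1 + log2 n%:R / 2 : R).
Hypothesis lam_gt0 : 0 < lam.
Hypothesis sparse : forall t i j, (t < tau R n)%N ->
  density A (Xset G x0 t i) (Yset G x0 t j) <= lam / (8 * m).

Lemma norm2_growth_step c K t : 0 <= c -> (t < tau R n)%N -> dyadic K (xs t) ->
  (K * tau R n)%:R <= 3 * m ^+ 2 * c ^+ 2 ->
  norm2 (ys t) <= lam / 2 * c * norm2 (xs t).
Proof.
move=> c0 tt xd Kc; have m1 : 1 <= m by have := log2_ge0 R n_gt0; lra.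
have d0 : 0 <= lam / (8 * m) by rewrite divr_ge0 ?(ltW lam_gt0) ?mulr_ge0 //; lra.
have nL : 2 ^- tau R n <= (2 * Num.sqrt n%:R)^-1 :> R.
  rewrite lef_pV2 ?posrE ?exprn_gt0 ?mulr_gt0 ?sqrt_n_gt0 //.
  exact: two_sqrt_le_exp_tau.
have := norm2_round_le A0 (growth_ge0 t) n_gt0 d0 xd nL
  (fun i j => sparse i j tt).
by apply: le_of_sqr_density_bound => //; rewrite ?norm2_ge0 ?ltW //; lra.
Qed.

Variables c0 c : R.
Hypotheses (c0_ge0 : 0 <= c0) (c_ge0 : 0 <= c).
Hypothesis c0_step : (tau R n)%:R <= 3 * m ^+ 2 * c0 ^+ 2.
Hypothesis c_step : ((tau R n).+1 * tau R n)%:R <= 3 * m ^+ 2 * c ^+ 2.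

(** The first step multiplies the norm by at most [lam / 2 * c0], each later one by at most
    [lam / 2 * c]; pruning never increases it. *)
Lemma norm2_round_growth t : (t < tau R n)%N ->
  norm2 (ys t) <= (lam / 2) ^+ t.+1 * (c0 * c ^+ t) * Num.sqrt n%:R.
Proof.
have l0 : 0 <= lam / 2 by rewrite divr_ge0 ?(ltW lam_gt0).
elim: t => [|t IH] tt.
  have := norm2_growth_step c0_ge0 tt (growth_dyadic 0).
  rewrite mul1n => /(_ c0_step) /le_trans; apply.
  rewrite expr0 expr1 mulr1; apply: ler_wpM2l (norm2_growth0); exact: mulr_ge0.
have := norm2_growth_step c_ge0 tt (growth_dyadic t.+1) c_step.
move=> /le_trans; apply.
have := le_trans (norm2_growthS t) (IH (ltnW tt)).
move=> /(ler_wpM2l (mulr_ge0 l0 c_ge0)) /le_trans; apply.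
by rewrite le_eqVlt; apply/orP; left; apply/eqP; rewrite [in RHS]exprS [c ^+ t.+1]exprS; ring.
Qed.

(** * Growth of the inner product with a subeigenvector, and the contradiction *)

Variables (w : 'rV[R]_n) (a : R).
Hypothesis w_ge0 : forall u, 0 <= w 0 u.
Hypothesis w_subeigen : forall u, lam * w 0 u <= (w *m A) 0 u.
Hypothesis x0_max : a = inner x0 w.
Hypotheses (lpart_max : inner (ind R L) w <= a) (rpart_max : inner (ind R Rt) w <= a).

Let a_ge0 : 0 <= a.
Proof. by rewrite x0_max; apply: inner_ge0 => // u; exact: (growth_ge0 0). Qed.

(** Rounding only increases entries, and symmetry moves [A] onto [w]. *)
Lemma inner_round_growth t : lam * inner (xs t) w <= inner (ys t) w.
Proof.
have x_ge0 := growth_ge0 t.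
apply: le_trans (_ : inner (xs t *m A) w <= _); last first.
  by apply: ler_inner => // u; have /andP[] := round_growth_bounds t u.
by rewrite inner_mx_sym // innerC -innerZl; apply: ler_inner => // u; rewrite mxE.
Qed.

Lemma inner_growth t : (t < tau R n)%N ->
  lam ^+ t * a * (1 - \sum_(s < t) c0 * c ^+ s / 8) <= inner (xs t) w.
Proof.
elim: t => [|t IH] tt; first by rewrite big_ord0 subr0 expr0 mul1r mulr1 x0_max.
have {}IH := IH (ltnW tt).
(* [z] is the part removed by pruning: one-sided, with entries at most the threshold. *)
set e := eps_sched R n t.+1; set z := ys t - xs t.+1.
have zuE u : z 0 u = if ys t 0 u <= e * norm2 (ys t) then ys t 0 u else 0.
  rewrite [LHS]mxE [X in _ + X]mxE [xs t.+1 0 u]mxE.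
  by case: ifP; rewrite ?subr0 ?subrr.
have z_side : one_sided z.
  have [h|h] := round_growth_one_sided (growth_one_sided t); [left|right] => u uP;
    by rewrite zuE h // if_same.
have eN0 : 0 <= e * norm2 (ys t) by rewrite mulr_ge0 ?eps_sched_ge0 ?norm2_ge0.
have z_le u : z 0 u <= e * norm2 (ys t) by rewrite zuE; case: ifP.
have loss := one_sided_inner_le w_ge0 z_side z_le eN0 lpart_max rpart_max.
have zE : inner z w = inner (ys t) w - inner (xs t.+1) w.
  by rewrite innerDl -scaleN1r innerZl mulN1r.
(* The factor [2 ^+ t.+1] in [eps_sched] cancels the halvings in the norm bound, and [sqrt n]
   cancels as well, leaving 1/8. *)
have le_loss : e * norm2 (ys t) <= lam ^+ t.+1 * (c0 * c ^+ t / 8).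
  have s0 := sqrt_n_gt0.
  apply: le_trans (ler_wpM2l (eps_sched_ge0 _) (norm2_round_growth (ltnW tt))) _.
  rewrite le_eqVlt; apply/orP; left; apply/eqP; rewrite /e /eps_sched expr_div_n.
  by field; rewrite !gt_eqF ?exprn_gt0.
have := ler_wpM2r a_ge0 le_loss.
have := inner_round_growth t.
have := ler_wpM2l (ltW lam_gt0) IH.
rewrite big_ord_recr /= exprS; move: loss; rewrite zE; set S := \sum_(s < t) _.
have -> : lam * lam ^+ t * a * (1 - (S + c0 * c ^+ t / 8)) =
  lam * (lam ^+ t * a * (1 - S)) - lam * lam ^+ t * (c0 * c ^+ t / 8) * a by ring.
lra.
Qed.

(** At the last step [T = tau - 1], the inner product of the rounded vector with [w] is at least
    [lam ^+ tau * a] times 1 minus the losses. It is also at most [a] times the norm, hence at most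
    [lam ^+ tau * a * (c0 * c ^+ T / 2)], because [2 ^+ tau >= 2 * sqrt n]. *)
Lemma growth_contradiction (T : nat) : tau R n = T.+1 -> 0 < a ->
  \sum_(s < T) c0 * c ^+ s / 8 + c0 * c ^+ T / 2 < 1 -> False.
Proof.
move=> tauT a_gt0 small.
have TT : (T < tau R n)%N by rewrite tauT.
have s0 := sqrt_n_gt0.
have := inner_growth TT; set S := \sum_(s < T) _ in small *.
move=> /(ler_wpM2l (ltW lam_gt0)) /le_trans /(_ (inner_round_growth T)).
have := one_sided_inner_le w_ge0 (round_growth_one_sided (growth_one_sided T))
  (coord_le_norm2 _) (norm2_ge0 _) lpart_max rpart_max.
move=> le1 /le_trans /(_ le1).
have := ler_wpM2r a_ge0 (norm2_round_growth TT).
move=> le2 /le_trans /(_ le2).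
have pT : 0 < 2 ^+ T.+1 :> R by rewrite exprn_gt0.
have := two_sqrt_le_exp_tau R n_gt0; rewrite tauT => two.
have lT : 0 < lam ^+ T.+1 by rewrite exprn_gt0.
have -> : (lam / 2) ^+ T.+1 * (c0 * c ^+ T) * Num.sqrt n%:R * a =
    lam ^+ T.+1 * a * (c0 * c ^+ T * (Num.sqrt n%:R / 2 ^+ T.+1)).
  by rewrite expr_div_n; field; rewrite gt_eqF.
have -> : lam * (lam ^+ T * a * (1 - S)) = lam ^+ T.+1 * a * (1 - S).
  by rewrite exprS; ring.
rewrite ler_pM2l ?mulr_gt0 // => le3.
have half : Num.sqrt n%:R / 2 ^+ T.+1 <= 1 / 2 :> R by rewrite ler_pdivrMr //; lra.
have := ler_wpM2l (mulr_ge0 c0_ge0 (exprn_ge0 T c_ge0)) half.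
lra.
Qed.

End Run.

(** * Existence of a dense candidate and of an output *)

Lemma dense_candidate lam : eigenvalue A lam -> 0 < lam ->
  exists x0 t i j, density_candidate G x0 t i j /\
    lam / (8 * (1 + log2 n%:R / 2)) <= density A (Xset G x0 t i) (Yset G x0 t j).
Proof.
move=> eig lam0; apply: contrapT => no.
have [w [w0 wN0] wlam] := subeigenvector eig (ltW lam0).
have n_gt0 := rV_neq0_dim_gt0 wN0.
set d := lam / _ in no; have log0 := log2_ge0 R n_gt0.
have d0 : 0 <= d by rewrite divr_ge0 ?ltW //; lra.
(* Pairs with an empty level are not candidates, but their density is 0. *)
have sparse x0 t i j : start_vector G x0 -> (t < tau R n)%N ->
    density A (Xset G x0 t i) (Yset G x0 t j) <= d.
  move=> st tt.
  have [->|X0] := eqVneq (Xset G x0 t i) set0; first by rewrite density_set0 //; left.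
  have [->|Y0] := eqVneq (Yset G x0 t j) set0; first by rewrite density_set0 //; right.
  rewrite leNgt; apply/negP => /ltW dens; apply: no.
  by exists x0, t, i, j.
case tauT: (tau R n) (tau_gt0 R n_gt0) => [//|T] _.
have [c0 [c [c00 cc0 c0_step c_step small]]] :
    exists c0 c : R, [/\ 0 <= c0, 0 <= c,
      T.+1%:R <= 3 * (1 + log2 n%:R / 2) ^+ 2 * c0 ^+ 2,
      (T.+2 * T.+1)%:R <= 3 * (1 + log2 n%:R / 2) ^+ 2 * c ^+ 2 &
      \sum_(s < T) c0 * c ^+ s / 8 + c0 * c ^+ T / 2 < 1].
  apply: decay_rates; first lra.
  by have := tau_bounds R n_gt0; rewrite tauT -natr1; lra.
(* The two sides cover all vertices, so these weights add up to the sum of the entries of [w]; the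
   heavier side therefore has positive weight. *)
have w_sum : 0 < inner (ind R L) w + inner (ind R Rt) w.
  rewrite -innerDl lt_def inner_ge0 // ?andbT => [|u]; last first.
    by rewrite !mxE addr_ge0.
  apply: contra_neq wN0 => sum0; apply/rowP => u; rewrite mxE.
  have ind1 v : (ind R L + ind R Rt) 0 v = 1.
    by rewrite !mxE -rpartN; case: (v \in Rt); rewrite ?add0r ?addr0.
  have := sum0; rewrite /inner; under eq_bigr do rewrite ind1 mul1r.
  by move/psumr_eq0P => ->.
have main (P : {set 'I_n}) : start_vector G (ind R P) ->
    inner (ind R L) w <= inner (ind R P) w ->
    inner (ind R Rt) w <= inner (ind R P) w -> False.
  move=> st leL leR; rewrite -tauT in c0_step c_step.
  apply: (growth_contradiction st n_gt0 lam0 _ c00 cc0 c0_step _ w0 wlam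
    (erefl _) leL leR tauT _ small) => //.
    by move=> t i j tt; exact: sparse.
  by move: w_sum leL leR; lra.
have [LR|/ltW RL] := lerP (inner (ind R L) w) (inner (ind R Rt) w).
  by apply: (main Rt) => //; right.
by apply: (main L) => //; left.
Qed.

(* Candidates range over infinitely many times and levels, but only over finitely
   many pairs of sets. *)
Lemma density_output_exists : (0 < n)%N ->
  exists x0 t i j, density_output G x0 t i j.
Proof.
move=> n_gt0.
pose cand (p : {set 'I_n} * {set 'I_n}) := `[< exists x0 t i j,
  density_candidate G x0 t i j /\ p = (Xset G x0 t i, Yset G x0 t j) >].
have candI x0 t i j : density_candidate G x0 t i j ->
    cand (Xset G x0 t i, Yset G x0 t j).
  by move=> h; apply/asboolP; exists x0, t, i, j.
have [[x0 [t [i [j h]]]]|no] := pselect (exists x0 t i j, density_candidate G x0 t i j).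
  have := @arg_maxP _ _ _ _ cand (fun p => density A p.1 p.2) (candI _ _ _ _ h).
  case=> _ /asboolP[x1 [t1 [i1 [j1 [h1 ->]]]]] hmax.
  have [st tt _ _] := h1; exists x1, t1, i1, j1.
  by split=> // x' t' i' j' h'; split=> //; exact: (hmax _ (candI _ _ _ _ h')).
exists (ind R L), 0%N, 0, 0; split; [by left|exact: tau_gt0|].
by move=> x' t' i' j' h'; case: no; exists x', t', i', j'.
Qed.

End Density.

Theorem theorem3 (R : realType) (n : nat) (G : bipartiteGraph R n) (lam : R)
    (hlam : largest_eigenvalue (adj G) lam) :
  exists (x0 : 'rV[R]_n) (t : nat) (i j : int),
    [/\ start_vector G x0,
        (t <= tau R n)%N,
        density_output G x0 t i j,
        density (adj G) (Xset G x0 t i) (Yset G x0 t j)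
          >= lam / (8 + 4 * log2 n%:R) &
        lam / (8 + 4 * log2 n%:R) >= max_density G / (8 + 4 * log2 n%:R)].
Proof.
have lam_ge0 := eigenvalue_ge0 hlam.
have n_gt0 : (0 < n)%N.
  by case: hlam => /eigenvalueP[v _ /rV_neq0_dim_gt0].
have log0 := log2_ge0 R n_gt0.
have [x0 [t [i [j out]]]] := density_output_exists G n_gt0.
have [st tt omax] := out; exists x0, t, i, j; split=> //; first exact: ltnW.
  (* For [lam = 0] there may be no candidate, and nonnegativity of the density suffices. *)
  have [->|lam_neq0] := eqVneq lam 0.
    by rewrite mul0r density_ge0 //; exact: adj_ge0.
  have lam_gt0 : 0 < lam by rewrite lt_def lam_neq0.
  have [x1 [t1 [i1 [j1 [h1 dens]]]]] := dense_candidate hlam.1 lam_gt0.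
  have -> : 8 + 4 * log2 n%:R = 8 * (1 + log2 n%:R / 2) :> R by lra.
  exact: le_trans dens (omax _ _ _ _ h1).2.
rewrite ler_wpM2r ?invr_ge0 //; first lra.
exact: max_density_le.
Qed.
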